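(* Let $B$ be a $T_{1}$ topological space, and let $0\in B$ be a point such that the subspace $B\setminus\{0\}$ is compact. Then for every cardinal $\kappa$ the space $X:=B^{\kappa}\setminus\{\vec{0}\}$ is discretely star-Lindelöf, where $\vec{0}\in B^{\kappa}$ is the point all of whose coordinates are equal to $0$.
   Context: $B^{\kappa}$ carries the product topology, and $X$ the subspace topology. ''Compact'' means every open cover has a finite subcover (no Hausdorff assumption). For a family $\mathcal{U}$ of subsets of a space $X$ and $F\subset X$, put $\mathrm{St}(F,\mathcal{U}):=\bigcup\{U\in\mathcal{U}: U\cap F\neq\emptyset\}$. A topological space $X$ is discretely star-Lindelöf if for every open cover $\mathcal{U}$ of $X$ there exists a countable set $F\subset X$ which is closed in $X$ and discrete (in the subspace topology) such that $\mathrm{St}(F,\mathcal{U})=X$. *)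

(* Defs.v *)
From mathcomp Require Import all_boot all_order all_algebra.
From mathcomp Require Import all_classical all_reals all_analysis.

Set Implicit Arguments.
Unset Strict Implicit.
Unset Printing Implicit Defensive.

Local Open Scope classical_set_scope.

Definition star (T : Type) (F : set T) (U : set (set T)) : set T :=
  \bigcup_(V in [set V | U V /\ V `&` F !=set0]) V.

(* [set A] below is the type of subsets of the subtype of T given by A, which
   MathComp-Analysis endows with the subspace topology of T. *)
Definition discrete_in (T : topologicalType) (A : set T) : Prop :=
  forall D : set A, open D.

Definition discretely_star_lindelof (T : topologicalType) : Prop :=
  forall U : set (set T),
    (forall V, U V -> open V) -> \bigcup_(V in U) V = [set: T] ->
    exists F : set T,
      [/\ countable F, closed F, discrete_in F & star F U = [set: T]].

(* Main.v *)
(** Write [0] for the base point. A countable set [F] such that every coordinate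
    is nonzero at only finitely many points of [F] is closed and discrete in [X],
    so it suffices to find such an [F] meeting enough members of the cover [U].
    Each set [{x | x k <> 0}] is compact, so there are finitely many members of
    [U] and a finite set [S k] of coordinates such that every [x] with [x k <> 0]
    has one of them, [V], containing all points that agree with [x] on [S k].
    Closing singletons under [S] gives countable sets; a well-order of [K] then
    splits [K] into countable, well-ordered blocks such that [S k] only meets the
    block of [k] and earlier ones. Let [k] be the first element, in the
    enumeration of the first block met by the support of [x], at which [x] does
    not vanish: within [S k], [x] is supported in the block of [k], hence a point
    of [F] lies in [V] as soon as it agrees with a suitable [p] on that block and
    vanishes on the rest of [S k]. One function, indexed by the position [n] of
    [k], the index [i] of [V] and a label [l], serves all blocks at once: it
    copies [p] on each block labelled [l], where for each [n] the labels of the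
    finitely many earlier blocks met by [S k] avoid that of the block of [k]. At
    the [m]-th element of a block it can be nonzero only for [n <= m], for the
    label of that block and for finitely many [i]. *)
Require Import Defs.
From mathcomp Require Import all_boot all_order all_algebra finmap.
From mathcomp Require Import all_classical all_reals all_analysis.
From mathcomp Require Import wochoice.

Local Open Scope classical_set_scope.

(** * Well-orders and countable blocks *)

Lemma exists_well_order (T : Type) : exists R : T -> T -> Prop,
  [/\ forall x y, R x y -> R y x -> x = y, well_founded (fun x y => R x y /\ x <> y) &
    forall A : set T, A !=set0 -> exists2 x, A x & forall y, A y -> R x y].
Proof.
have [R wR] := well_ordering_principle {classic T}.
have minR (A : set {classic T}) : A !=set0 ->
    exists2 x, A x & forall y, A y -> R x y.
  move=> [a Aa]; have [|x [[Ax xR] _]] := wR (mem A).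
    by exists a; rewrite inE.
  exists x; first by move: Ax; rewrite inE.
  by move=> y Ay; apply: xR; rewrite inE.
have Rxx (x : {classic T}) : R x x.
  by have [_ -> xR] := minR [set x] (ex_intro _ x erefl); apply: xR.
have Ranti (x y : {classic T}) : R x y -> R y x -> x = y.
  (* Both [x] and [y] are least in the pair, and least elements are unique. *)
  move=> xy yx; have [|z [_ zP]] := wR (mem [set x; y]).
    by exists x; rewrite inE; left.
  rewrite -(zP x) ?(zP y) //; split; rewrite ?inE; [by right| |by left|];
    by move=> u; rewrite inE => -[|] ->.
exists R; split; [exact: Ranti| |exact: minR].
move=> x; apply: contrapT => xN.
have [y yN ymin] := minR [set x | ~ Acc (fun x y => R x y /\ x <> y) x]
  (ex_intro _ x xN).
apply: yN; constructor => z [zy zNy].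
apply: contrapT => zN; apply: zNy; apply: Ranti => //; exact: ymin.
Qed.

Lemma locally_finite_labelling (T : Type) (lt : T -> T -> Prop)
    (G : T -> set T) :
  well_founded lt -> (forall x, finite_set (G x)) ->
  exists e : T -> nat, forall x y, G x y -> lt y x -> e y <> e x.
Proof.
move=> wf Gfin.
pose step x (rec : forall y, lt y x -> nat) :=
  xget 0%N (~` [set k | exists y (yx : lt y x), G x y /\ rec y yx = k]).
pose e := Fix wf (fun=> nat) step.
have eE x : e x = step x (fun y _ => e y).
  apply: Fix_eq => {}x f g fg; rewrite /step; congr xget; congr (~` _).
  by apply/seteqP; split => k [y [yx [Gy <-]]]; exists y, yx; split.
exists e => x y Gxy yx exy.
set A := [set k | exists y (yx : lt y x), G x y /\ e y = k].
have Afin : finite_set A.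
  apply: sub_finite_set (finite_image e (Gfin x)) => k [z [_ [Gz <-]]].
  by exists z.
have [k kA] : (~` A) !=set0.
  apply/set0P/eqP => A0; apply: infinite_nat.
  by apply: sub_finite_set Afin => k _; apply: contrapT => kA;
    have : (~` A) k by []; rewrite A0.
have : (~` A) (e x) by rewrite [e x]eE; apply: (xgetPex 0%N); exists k.
by apply; exists y, yx.
Qed.

Lemma countable_closure (T : Type) (S : T -> set T) (a : T) :
  (forall x, countable (S x)) ->
  exists C : set T, [/\ countable C, C a & forall x, C x -> S x `<=` C].
Proof.
move=> cS.
pose D := fix D n := if n is n'.+1 then \bigcup_(x in D n') S x else [set a].
exists (\bigcup_n D n); split.
- apply: bigcup_countable => // n _; elim: n => [|n IH] /=; first exact: countable1.
  exact: bigcup_countable.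
- by exists 0%N.
- by move=> x [n _ Dx] y Sy; exists n.+1 => //; exists x.
Qed.

(** [blk x] names the block of [x] by one of its points, [idx x] is the position
    of [x] in its block, and [lab a n] is the label of the block [a] used for
    position [n]. *)
Lemma countable_blocks (T : Type) (S : T -> set T) :
  (forall x, finite_set (S x)) ->
  exists (blk : T -> T) (idx : T -> nat) (lab : T -> nat -> nat),
  [/\ forall x y, blk x = blk y -> idx x = idx y -> x = y,
    forall x y, S x y -> blk y <> blk x ->
      lab (blk y) (idx x) <> lab (blk x) (idx x) &
    forall A : set T, A !=set0 -> exists2 x, A x &
      forall y, A y ->
        (S x y -> blk y = blk x) /\ (blk y = blk x -> (idx x <= idx y)%N)].
Proof.
move=> Sfin.
have [R [Ranti Rwf Rmin]] := exists_well_order T.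
have /choice[C CP] a := countable_closure T S a
  (fun x => finite_set_countable (Sfin x)).
have /choice[g gP] a : exists f : T -> nat, {in C a &, injective f}.
  by apply/countable_injP; case: (CP a).
(* Taking the least [a] with [x] in [C a] makes each block a subset of a countable [C a]; as
   [C (blk x)] also contains [S x], the points of [S x] lie in no later block. *)
have /choice[blk blkP] x : exists a, C a x /\ forall b, C b x -> R a b.
  have [|a ? ?] := Rmin [set a | C a x]; last by exists a.
  by exists x; case: (CP x).
pose idx x := g (blk x) x.
have inj x y : blk x = blk y -> idx x = idx y -> x = y.
  rewrite /idx => xy; rewrite xy => /gP; apply; rewrite inE; last first.
    by case: (blkP y).
  by rewrite -xy; case: (blkP x).
have blkS x y : S x y -> R (blk y) (blk x).
  move=> Sxy; have [_ yP] := blkP y; have [xC _] := blkP x.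
  by apply: yP; have [_ _ /(_ _ xC)] := CP (blk x); apply.
(* Labels are chosen for each position [n] separately: a block has at most one point there, so only
   one finite [S x] counts. *)
pose G n a := [set b | exists x, [/\ blk x = a, idx x = n & (blk @` S x) b]].
have Gfin n a : finite_set (G n a).
  have [[x [xa xn]]|nx] := pselect (exists x, blk x = a /\ idx x = n).
    apply: sub_finite_set (finite_image blk (Sfin x)) => b [y [ya yn]].
    by rewrite (inj y x) // ?ya ?yn.
  by rewrite (_ : G n a = set0)// -subset0 => b [x [xa xn _]]; apply: nx; exists x.
have /choice[lab labP] n := locally_finite_labelling _ _ (G n) Rwf (Gfin n).
exists blk, idx, (fun a n => lab n a); split => //.
  move=> x y Sxy yx; apply: labP; last by split => //; exact: blkS.
  by exists x; split => //; exists y.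
move=> A [x0 Ax0].
have [|_ [x1 Ax1 <-] x1P] := Rmin (blk @` A); first by exists (blk x0), x0.
pose P n := `[< exists x, [/\ A x, blk x = blk x1 & idx x = n] >].
have exP : exists n, P n by exists (idx x1); apply/asboolP; exists x1.
case: (ex_minnP exP) => n /asboolP[x [Ax xx1 <-]] nP.
exists x => // y Ay; split.
  move=> /blkS Ryx; apply: Ranti => //.
  by rewrite xx1; apply: x1P; exists y.
by move=> yx; apply: nP; apply/asboolP; exists y; split => //; rewrite yx.
Qed.

(** * Compactness and closed discrete sets *)

(** If a filter has no cluster point in [A], the complements of the closures of its members cover
    [A]; a finite subcover yields an empty member. *)
Lemma cover_compact_compact (T : topologicalType) (A : set T) :
  cover_compact A -> compact A.
Proof.
move=> cA F FF FA; apply: contrapT => noclu.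
have [|x Ax|D' D'F AD'] := cA (set T) F (fun M => ~` closure M).
- by move=> M _; apply/closed_openC/closed_closure.
- apply: contrapT => xN; apply: noclu; exists x; split => //.
  rewrite clusterE => M FM; apply: contrapT => xM; apply: xN.
  by exists M.
have : F (A `&` \bigcap_(M in [set` D']) M).
  apply: filterI => //; apply: filter_bigI => M MD'.
  exact/set_mem/D'F.
move=> /filter_ex[x [/AD'[M MD' Mx] xD']].
by apply: Mx; apply: subset_closure; exact: xD'.
Qed.

Lemma compact_setC1T (B : topologicalType) (z : B) :
  cover_compact [set: set_type (~` [set z])] ->
  compact (~` [set z]) /\ compact [set: B].
Proof.
move=> /cover_compact_compact cB.
have cz : compact (~` [set z]).
  rewrite (_ : ~` [set z] = set_val @` [set: set_type (~` [set z])]).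
    apply: continuous_compact => //.
    by apply: continuous_subspaceT; exact: initial_continuous.
  apply/seteqP; split => [x xz|_ [x _ <-]].
    by exists (SigSub (mem_set xz)).
  exact: set_valP.
split => //; rewrite -(setvU [set z]).
by apply: compactU => //; exact: compact_set1.
Qed.

(** Every subset of [F] is closed: inside each [C i] it is finite, hence removable from an open set
    by T1. Discreteness follows. *)
Lemma locally_finite_closed_discrete (T : topologicalType) (I : Type)
    (C : I -> set T) (F : set T) :
  accessible_space T -> (forall i, open (C i)) -> \bigcup_i C i = setT ->
  (forall i, finite_set (F `&` C i)) -> closed F /\ discrete_in F.
Proof.
move=> /accessible_finite_set_closed T1 oC covC finF.
have sub_closed (G : set T) : G `<=` F -> closed G.
  move=> GF.
  have -> : G = ~` \bigcup_i (C i `&` ~` (G `&` C i)).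
    apply/seteqP; split => x.
      by move=> Gx [i _ [Cx]]; apply.
    move=> xN; have [i _ Cix] : (\bigcup_i C i) x by rewrite covC.
    by apply: contrapT => xG; apply: xN; exists i => //; split => // -[].
  apply: open_closedC; apply: bigcup_open => i _; apply: openI => //.
  apply: closed_openC; apply: T1; apply: sub_finite_set (finF i).
  by apply: setSI.
split; first exact: sub_closed.
move=> D; exists (~` (set_val @` (~` D))).
  by apply: closed_openC; apply: sub_closed => _ [x _ <-]; exact: set_valP.
apply/seteqP; split => x /=.
  by move=> xN; apply: contrapT => xD; apply: xN; exists x.
by move=> Dx [y yD /val_inj yx]; apply: yD; rewrite yx.
Qed.

(** * Cylinders and compactness in powers *)

Definition cylinder {K B : Type} (S : set K) (x : K -> B) : set (K -> B) :=
  [set v | forall s, S s -> v s = x s].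

Lemma cylinderS {K B : Type} {S S' : set K} {x : K -> B} :
  S `<=` S' -> cylinder S' x `<=` cylinder S x.
Proof. by move=> SS' v vx s /SS'; exact: vx. Qed.

Lemma ptws_evaluation_continuous (K : Type) (B : topologicalType) (k : K) :
  continuous (fun x : {ptws K -> B} => x k).
Proof. exact: (@proj_continuous {classic K} (fun=> B) k). Qed.

(** The sets [O] with the required property form a filter, so it suffices to test neighbourhoods
    that depend on one coordinate. *)
Lemma ptws_nbhs_cylinder (K : Type) (B : topologicalType)
    (x : {ptws K -> B}) (O : set {ptws K -> B}) : nbhs x O ->
  exists2 S : set K, finite_set S &
    nbhs x [set y : {ptws K -> B} | cylinder S y `<=` O].
Proof.
pose cyl : set_system {ptws K -> B} := fun N => exists2 S : set K, finite_set S &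
  nbhs x [set y : {ptws K -> B} | cylinder S y `<=` N].
have cylF : Filter cyl.
  apply: Build_Filter.
  - exists set0; first exact: finite_set0.
    by apply: filterS filterT => y _.
  - move=> P Q [S fS SP] [S' fS' SQ]; exists (S `|` S').
      by rewrite finite_setU; split.
    apply: filterS (filterI SP SQ) => y [yP yQ] v vy.
    by split; [apply: yP | apply: yQ]; apply: cylinderS vy => s; [left|right].
  - move=> P Q PQ [S fS SP]; exists S => //.
    by apply: filterS SP => y yP v /yP /PQ.
suff : cyl --> x by apply.
apply/cvg_sup => k W [V [[N oN <-] Nx VW]].
exists [set k]; first exact: finite_set1.
have : nbhs x [set y : {ptws K -> B} | N (y k)].
  by apply: ptws_evaluation_continuous; exact: open_nbhs_nbhs.
by apply: filterS => y Ny v vy; apply: VW; rewrite /= (vy k).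
Qed.

Lemma compact_cylinder_cover (K : Type) (B : topologicalType)
    (C : set {ptws K -> B}) (U : set (set {ptws K -> B})) :
  compact C -> (forall V, U V -> open V) -> C `<=` \bigcup_(V in U) V ->
  exists (S : set K) (W : seq (set {ptws K -> B})),
  [/\ finite_set S, forall V, V \in W -> U V &
    forall x, C x -> exists2 V, V \in W & cylinder S x `<=` V].
Proof.
move=> /compact_near_coveringP ncC oU CU.
(* [near_covering] is used with the filter of pairs (finite set of coordinates,
   finite list of members of the cover) directed by inclusion. *)
pose data := (set K * seq (set {ptws K -> B}))%type.
pose good (d : data) := finite_set d.1 /\ forall V, V \in d.2 -> U V.
pose above (d : data) :=
  [set d' : data | good d' /\ d.1 `<=` d'.1 /\ {subset d.2 <= d'.2}].
pose P (d : data) (x : {ptws K -> B}) :=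
  exists2 V, V \in d.2 & cylinder d.1 x `<=` V.
have FF : Filter (filter_from good above).
  apply: filter_from_filter.
    by exists (set0, [::]); split => //; exact: finite_set0.
  move=> [S1 W1] [S2 W2] [/= S1f W1U] [/= S2f W2U].
  exists (S1 `|` S2, W1 ++ W2).
    split => /=; first by rewrite finite_setU; split.
    by move=> V; rewrite mem_cat => /orP[/W1U|/W2U].
  move=> d [gd [/= S12 W12]]; split; split => //; split.
  - by move=> s ?; apply: S12; left.
  - by move=> V VW; apply: W12; rewrite mem_cat VW.
  - by move=> s ?; apply: S12; right.
  - by move=> V VW; apply: W12; rewrite mem_cat VW orbT.
have [x Cx|[S W] [Sf WU] SW] := ncC data _ P FF.
  have [V UV Vx] := CU x Cx.
  have [S Sf Sx] := ptws_nbhs_cylinder _ _ _ _ (open_nbhs_nbhs (conj (oU V UV) Vx)).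
  exists ([set y : {ptws K -> B} | cylinder S y `<=` V], above (S, [:: V])).
    split => //; exists (S, [:: V]) => //; split => // V'.
    by rewrite inE => /eqP ->.
  move=> [y d] [/= yV [_ [Sd Vd]]]; exists V.
    by apply: Vd; rewrite inE.
  by move=> v /(cylinderS Sd) /yV.
exists S, W; split => // x Cx.
have /SW : above (S, W) (S, W) by split; [split|split=> //=].
exact.
Qed.

(** Tychonoff, with the factor at [k] replaced by the complement of [z]. *)
Lemma ptws_compact_neq (K : Type) (B : topologicalType) (z : B) (k : K) :
  compact (~` [set z]) -> compact [set: B] ->
  compact [set x : {ptws K -> B} | x k <> z].
Proof.
move=> cz cB.
pose A (i : {classic K}) : set B := if i == k then ~` [set z] else setT.
have := @tychonoff {classic K} (fun=> B) A.
have -> : [set f : forall i : {classic K}, B | forall i, A i (f i)] =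
    [set x : {ptws K -> B} | x k <> z].
  apply/seteqP; split => x /=.
    by move/(_ k); rewrite /A eqxx.
  by move=> xk i; rewrite /A; case: eqP => // ->.
by apply => i; rewrite /A; case: ifP.
Qed.

Lemma subtype_accessible (T : topologicalType) (A : set T) :
  accessible_space T -> accessible_space (set_type A).
Proof.
move=> T1 x y xy; have [|O [oO xO yO]] := T1 (set_val x) (set_val y).
  by apply: contra xy => /eqP /val_inj ->.
exists (set_val @^-1` O); split.
- by apply: open_comp oO => // u _; exact: initial_continuous.
- exact: mem_set (set_mem xO).
- exact: mem_set (set_mem yO).
Qed.

Lemma ptws_accessible (K : Type) (B : topologicalType) :
  accessible_space B -> accessible_space {ptws K -> B}.
Proof.
move=> T1 x y /eqP xy.
have [k xyk] : exists k, x k <> y k.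
  by apply: contrapT => /forallNP xyE; apply: xy; apply/funext => k; apply: contrapT; exact: xyE.
have [|O [oO xO yO]] := T1 (x k) (y k); first exact/eqP.
exists [set v : {ptws K -> B} | O (v k)]; split.
- by apply: open_comp oO => v _; exact: ptws_evaluation_continuous.
- exact: mem_set (set_mem xO).
- exact: mem_set (set_mem yO).
Qed.

(** * The countable family of functions *)

Lemma pointwise_finite_hitting (K B : Type) (z : B) (S : K -> set K)
    (W : K -> seq (set (K -> B))) :
  (forall k, finite_set (S k)) ->
  (forall k x, x k <> z -> exists2 V, V \in W k & cylinder (S k) x `<=` V) ->
  exists f : nat * nat * nat -> K -> B,
  (forall k, finite_set [set t | f t k <> z]) /\
  forall x, x <> (fun=> z) -> exists k t V, [/\ V \in W k, V x & V (f t)].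
Proof.
move=> Sfin SW.
have [blk [idx [lab [inj labP minP]]]] := countable_blocks K S Sfin.
(* The clause on other blocks lets labels reproduce [q] on [S a]; the clause on earlier positions
   keeps the family finite at each coordinate. *)
pose good a i := [set q : K -> B |
  [/\ (i < size (W a))%N, cylinder (S a) q `<=` nth set0 (W a) i,
   forall b, S a b -> blk b <> blk a -> q b = z &
   forall b, blk b = blk a -> (idx b < idx a)%N -> q b = z]].
have /choice[p pP] (ai : K * nat) : exists q : K -> B,
    (good ai.1 ai.2 !=set0 -> good ai.1 ai.2 q) /\
    (~ (good ai.1 ai.2 !=set0) -> q = fun=> z).
  have [[q gq]|ng] := pselect (good ai.1 ai.2 !=set0).
    by exists q; split => // -[]; exists q.
  by exists (fun=> z); split.
have pz a i d : blk d = blk a -> p (a, i) d <> z ->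
    (i < size (W a))%N /\ (idx a <= idx d)%N.
  move=> da pd; have [/(pP (a, i)).1[ilt _ _ pz]|/(pP (a, i)).2 pE] :=
    pselect (good a i !=set0); last by rewrite pE in pd.
  split => //; rewrite leqNgt; apply/negP => dlt; apply: pd; exact: pz.
(* [ent (d, n)] is the point at position [n] of the block of [d]; if there is none, it is some point
   of that block, which the test on [idx] in [f] rejects. *)
have /choice[ent entP] (dn : K * nat) : exists a, blk a = blk dn.1 /\
    forall b, blk b = blk dn.1 -> idx b = dn.2 -> a = b.
  have [[a [ad an]]|na] := pselect (exists a, blk a = blk dn.1 /\ idx a = dn.2).
    exists a; split => // b bd bn.
    by apply: inj; [rewrite bd|rewrite bn].
  by exists dn.1; split => // b bd bn; case: na; exists b.
pose f (t : nat * nat * nat) d := let a := ent (d, t.1.1) in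
  if (idx a == t.1.1) && (lab (blk d) t.1.1 == t.2) then p (a, t.1.2) d else z.
exists f; split.
  move=> k.
  pose D := \bigcup_(n in `I_(idx k).+1) \bigcup_(i in `I_(size (W (ent (k, n)))))
    [set (n, i, lab (blk k) n)].
  apply: (@sub_finite_set _ _ D).
    move=> [[n i] l]; rewrite /f /=; case: ifP => [/andP[/eqP an /eqP lE]|//].
    have [ak _] := entP (k, n).
    move=> /(pz _ _ _ (esym ak))[ilt]; rewrite an => nle.
    by exists n => //; exists i => //; rewrite -lE.
  apply: bigcup_finite => [|n _]; first exact: finite_II.
  apply: bigcup_finite => [|i _]; first exact: finite_II.
  exact: finite_set1.
move=> x x0.
have [|a xa aP] := minP [set k | x k <> z].
  apply: contrapT => xN; apply: x0; apply/funext => k.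
  by apply: contrapT => xk; apply: xN; exists k.
have [V VW xV] := SW a x xa.
have [|ilt pV pz0 _] := (pP (a, index V (W a))).1.
  (* By the choice of [a], the point [x] itself is an admissible pattern. *)
  exists x; split; first by rewrite index_mem.
  - by rewrite nth_index.
  - move=> b Sb ba; apply: contrapT => xb; apply: ba.
    exact: (aP b xb).1.
  - move=> b ba; rewrite ltnNge => /negP ab; apply: contrapT => xb; apply: ab.
    exact: (aP b xb).2.
rewrite /= nth_index // in pV.
exists a, (idx a, index V (W a), lab (blk a) (idx a)), V; split => //.
  exact: xV.
(* On the block of [a], [f] copies [p]; on the rest of [S a] both vanish, the labels being
   different. *)
apply: pV => s Ss; rewrite /f /=.
have [sa|sa] := pselect (blk s = blk a).
  rewrite (_ : ent (s, idx a) = a) ?sa ?eqxx //.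
  by apply: (entP (s, idx a)).2.
rewrite pz0 //; case: eqP => //= _; case: eqP => // lE.
by have := labP a s Ss sa.
Qed.

Theorem theorem4 (B : topologicalType) (zero : B)
  (B_T1 : accessible_space B)
  (cptB0 : cover_compact [set: set_type (~` [set zero])])
  (K : Type) :
  discretely_star_lindelof (set_type (~` [set (fun=> zero)] : set {ptws K -> B})).
Proof.
set X0 : set {ptws K -> B} := ~` [set (fun=> zero)].
move=> U oU covU.
have [cB0 cB] := compact_setC1T _ _ cptB0.
have T1 := ptws_accessible K _ B_T1.
have oX0 : open X0 by apply/closed_openC/accessible_closed_set1.
pose U' : set (set {ptws K -> B}) := [set set_val @` V | V in U].
have oU' V : U' V -> open V.
  move=> [V' /oU[N oN <-] <-].
  rewrite (_ : _ @` _ = N `&` X0); first exact: openI.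
  apply/seteqP; split => [_ [x Nx <-]|x [Nx Xx]].
    by split => //; exact: set_valP.
  by exists (SigSub (mem_set Xx)).
have X0neq (k : K) (x : {ptws K -> B}) : x k <> zero -> X0 x.
  by move=> xk x0; apply: xk; rewrite x0.
have /choice[SW SWP] k : exists SW : set K * seq (set {ptws K -> B}),
    [/\ finite_set SW.1, forall V, V \in SW.2 -> U' V &
    forall x, x k <> zero -> exists2 V, V \in SW.2 & cylinder SW.1 x `<=` V].
  have [|S [W SWP]] := compact_cylinder_cover _ _ _ U'
    (ptws_compact_neq K B zero k cB0 cB) oU'; last by exists (S, W).
  move=> x /X0neq Xx; have [V UV Vx] : (\bigcup_(V in U) V) (SigSub (mem_set Xx)).
    by rewrite covU.
  by exists (set_val @` V); [exists V|exists (SigSub (mem_set Xx))].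
have [||f [ffin fhit]] := pointwise_finite_hitting K B zero
  (fun k => (SW k).1) (fun k => (SW k).2).
- by move=> k; case: (SWP k).
- by move=> k; case: (SWP k).
(* Some [f t] may be the zero function; only the others give points of [F]. *)
pose F := [set x : set_type X0 | exists t, set_val x = f t].
have F1 t : finite_set [set x : set_type X0 | set_val x = f t].
  have [[x xt]|nx] := pselect (exists x : set_type X0, set_val x = f t).
    apply: sub_finite_set (finite_set1 x) => y yt.
    by apply: val_inj; rewrite [LHS]yt.
  by rewrite (_ : mkset _ = set0)// -subset0 => x xt; apply: nx; exists x.
exists F.
have [] := locally_finite_closed_discrete (set_type X0) K
  (fun k => [set x | set_val x k <> zero]) F.
- exact: subtype_accessible.
- move=> k; exists [set x : {ptws K -> B} | x k <> zero] => //.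
  apply: (open_comp (f := fun x : {ptws K -> B} => x k) (D := ~` [set zero])).
    by move=> x _; exact: ptws_evaluation_continuous.
  by apply/closed_openC/accessible_closed_set1.
- apply/seteqP; split => // x _; apply: contrapT => xN.
  apply: (set_valP x); apply/funext => k; apply: contrapT => xk.
  by apply: xN; exists k.
- move=> k; apply: sub_finite_set
    (bigcup_finite (ffin k) (fun t _ => F1 t)) => x [[t xt] xk].
  by exists t => //=; rewrite -xt.
move=> clF dF; split => //.
  rewrite (_ : F = \bigcup_t [set x | set_val x = f t]).
    by apply: bigcup_countable => // t _; exact: finite_set_countable.
  by apply/seteqP; split => x [t]; exists t.
apply/seteqP; split => // x _.
have [k [t [V [VW Vx Vt]]]] := fhit (set_val x) (set_valP x).
(* Being the image of a subset of the subspace, [V] forces [f t] to be nonzero and so to come from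
   [F]. *)
have [_ /(_ V VW)[V' UV' VE] _] := SWP k; rewrite -VE in Vx Vt.
case: Vx => x' V'x' /val_inj x'x; case: Vt => y V'y yt.
exists V'; last by rewrite -x'x.
by split => //; exists y; split => //; exists t.
Qed.
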